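(* Let $\mathbb F$ be an algebraically closed field of characteristic zero. Let $L:\mathbb F^n\to\mathbb F^m$ and $M:\mathbb F^r\to\mathbb F^m$ be polynomial maps with $\mathrm{im}(L)\subseteq\mathrm{im}(M)$. Let $\mathbf z=(z_1,\dots,z_n)$ be indeterminates. Then there exist $\mathbf c\in\mathbb F^n$ and formal power series $p_1(\mathbf z),\dots,p_r(\mathbf z)\in\mathbb F[[z_1,\dots,z_n]]$ such that $$L(\mathbf z+\mathbf c)=M(p_1(\mathbf z),\dots,p_r(\mathbf z))$$ as an equality in $\mathbb F[[z_1,\dots,z_n]]^m$.
   Context: A polynomial map $L=(L_1,\dots,L_m):\mathbb F^n\to\mathbb F^m$ is one whose components are polynomial functions. $\mathbb F[[z_1,\dots,z_n]]$ denotes the ring of formal power series around $\mathbf 0$; equality is coefficientwise. *)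

(* Defs.v *)
From HB Require Import structures.
From mathcomp Require Import all_boot all_order all_algebra.
Set Implicit Arguments. Unset Strict Implicit. Unset Printing Implicit Defensive.
Import Order.TTheory GRing.Theory Num.Theory.
Local Open Scope ring_scope.

Definition mono (n : nat) := {ffun 'I_n -> nat}.

(* A polynomial in n variables: a finite list of terms (coefficient, exponent
   vector), representing  \sum_t t.1 * z^(t.2). *)
Definition mpoly (F : Type) (n : nat) := seq (F * mono n).

Definition meval (F R : Type) (zero one : R) (add mul : R -> R -> R)
  (emb : F -> R) (n : nat) (p : mpoly F n) (x : 'I_n -> R) : R :=
  foldr (fun (t : F * mono n) acc =>
           add (mul (emb t.1)
                    (foldr (fun i acc' => mul (iter (t.2 i) (mul (x i)) one) acc')
                           one (enum 'I_n)))
               acc)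
        zero p.

Definition peval (F : comNzRingType) (n : nat) (p : mpoly F n) (x : 'I_n -> F) : F :=
  meval 0 1 +%R *%R id p x.

(* Formal power series in n variables: coefficient functions on multi-indices.
   Equality is coefficientwise (pointwise equality of coefficient functions). *)
Definition ps (F : Type) (n : nat) := mono n -> F.

Definition mdeg (n : nat) (a : mono n) : nat := \max_(i < n) a i.

Definition ps_const (F : comNzRingType) (n : nat) (c : F) : ps F n :=
  fun a => if a == [ffun=> 0%N] then c else 0.

Definition ps_var (F : comNzRingType) (n : nat) (i : 'I_n) : ps F n :=
  fun a => if a == [ffun j => (j == i) : nat] then 1 else 0.

Definition ps_add (F : comNzRingType) (n : nat) (f g : ps F n) : ps F n :=
  fun a => f a + g a.

(* Cauchy product: (fg)_a = \sum_{b <= a} f_b g_{a-b}; b ranges over exponent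
   vectors bounded pointwise by a (encoded with entries in 'I_(mdeg a).+1). *)
Definition ps_mul (F : comNzRingType) (n : nat) (f g : ps F n) : ps F n :=
  fun a => \sum_(b : {ffun 'I_n -> 'I_(mdeg a).+1} | [forall i, (b i <= a i)%N])
             f [ffun i => (b i : nat)] * g [ffun i => (a i - b i)%N].

Definition ps_eval (F : comNzRingType) (n k : nat) (p : mpoly F k) (s : 'I_k -> ps F n)
  : ps F n :=
  meval (@ps_const F n 0) (@ps_const F n 1) (@ps_add F n) (@ps_mul F n) (@ps_const F n) p s.

(* Main.v *)
Require Import Defs.
From HB Require Import structures.
From mathcomp Require Import all_boot all_order all_algebra.
From mathcomp Require Import boolp classical_sets functions filter.
From mathcomp Require Import ring.
Set Implicit Arguments. Unset Strict Implicit. Unset Printing Implicit Defensive.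
Import Order.TTheory GRing.Theory Num.Theory.
Local Open Scope ring_scope.

(** Iterating ultrapowers of F gives a field E containing algebraically independent
    elements z_1, ..., z_n over F in which the inclusion of images persists, so
    L(z) = M(y) for some y in E^r.  The ring F[z, y] is then mapped to F[[z]] one
    generator at a time, keeping the freedom to make the constant term of the image
    of any prescribed nonzero element nonzero.  A transcendental generator is sent to
    a constant (or, for z_i, to z_i plus a constant) avoiding finitely many values;
    an algebraic one is sent to the Hensel lift of a root of the specialization of
    its minimal polynomial, which is simple for a generic specialization by
    separability.  The images of y_1, ..., y_r are the power series sought. *)

(** * Formal power series as a local henselian ring *)

Section MultiIndex.
Variable n : nat.
Implicit Types a b c d e : mono n.

Definition madd b c : mono n := [ffun i => (b i + c i)%N].
Definition msub a b : mono n := [ffun i => (a i - b i)%N].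
Definition mle b a := [forall i, b i <= a i]%N.
(* [mdeg] of Defs is the largest exponent; this is the total degree. *)
Definition mtot a := (\sum_i a i)%N.

Lemma maddC b c : madd b c = madd c b.
Proof. by apply/ffunP => i; rewrite !ffunE addnC. Qed.

Lemma maddA b c d : madd b (madd c d) = madd (madd b c) d.
Proof. by apply/ffunP => i; rewrite !ffunE addnA. Qed.

Lemma madd_eq b c a : (madd b c == a) = mle b a && (c == msub a b).
Proof.
apply/eqP/andP => [<-|[/forallP ba /eqP ->]].
  split; first by apply/forallP => i; rewrite ffunE leq_addr.
  by apply/eqP/ffunP => i; rewrite !ffunE addKn.
by apply/ffunP => i; rewrite !ffunE subnKC.
Qed.

Lemma mtot_sub b a : mle b a -> (mtot b + mtot (msub a b))%N = mtot a.
Proof.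
move=> /forallP ba; rewrite /mtot -big_split; apply: eq_bigr => i _.
by rewrite ffunE /= subnKC.
Qed.

Definition mbox N : seq (mono n) :=
  [seq [ffun i => b i : nat] | b : {ffun 'I_n -> 'I_N.+1}].

Lemma mbox_uniq N : uniq (mbox N).
Proof.
rewrite map_inj_uniq ?enum_uniq // => b c /ffunP bc; apply/ffunP => i.
by apply/val_inj; have := bc i; rewrite !ffunE.
Qed.

Lemma mem_mbox N b : (b \in mbox N) = [forall i, b i <= N]%N.
Proof.
apply/mapP/forallP => [[c _ ->] i|bN]; first by rewrite ffunE -ltnS.
exists [ffun i => inord (b i)]; first by rewrite mem_enum.
by apply/ffunP => i; rewrite !ffunE inordK // ltnS.
Qed.

Lemma mbox_le N a b : a \in mbox N -> mle b a -> b \in mbox N.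
Proof.
rewrite !mem_mbox => /forallP aN /forallP ba; apply/forallP => i.
exact: leq_trans (ba i) (aN i).
Qed.

Lemma mbox_mdeg a : a \in mbox (mdeg a).
Proof. by rewrite mem_mbox; apply/forallP => i; apply: leq_bigmax. Qed.

End MultiIndex.

(** * Ring structure of formal power series under the Cauchy product *)

Section PowerSeries.
Variables (F : comNzRingType) (n : nat).
Implicit Types f g h : ps F n.

(** The bound [mdeg a] built into [ps_mul] depends on [a]. Every [b] below [a] lies in each box
    containing [a], so one common box can serve for all coefficients met in a nested product. *)
Lemma ps_mul_mbox N f g a : a \in mbox n N ->
  ps_mul f g a = \sum_(b <- mbox n N | mle b a) f b * g (msub a b).
Proof.
move=> aN; transitivity (\sum_(b <- mbox n (mdeg a) | mle b a) f b * g (msub a b)).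
  rewrite big_map big_enum_cond /=; apply: eq_big => [b|b _].
    by apply: eq_forallb => i; rewrite ffunE.
  by congr (_ * g _); apply/ffunP => i; rewrite !ffunE.
rewrite -[LHS]big_filter -[RHS]big_filter; apply: perm_big.
apply: uniq_perm; rewrite ?filter_uniq ?mbox_uniq // => b.
rewrite !mem_filter; case ba: (mle b a) => //=.
by rewrite (mbox_le aN ba) (mbox_le (mbox_mdeg a) ba).
Qed.

Lemma sum_mbox1 N (c : mono n) (x : F) :
  \sum_(d <- mbox n N) (if d == c then x else 0)
  = if c \in mbox n N then x else 0.
Proof.
case: ifP => cN.
  rewrite (bigD1_seq c) ?mbox_uniq //= eqxx big1 ?addr0 // => d /negPf ->//.
rewrite big_seq big1 // => d dN; case: eqP => // dc.
by rewrite -dc dN in cN.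
Qed.

(** This form is symmetric in the two factors, which reduces the ring axioms to exchanging finite
    sums. *)
Lemma ps_mul_pair N f g a : a \in mbox n N ->
  ps_mul f g a = \sum_(b <- mbox n N) \sum_(c <- mbox n N)
     if madd b c == a then f b * g c else 0.
Proof.
move=> aN; rewrite (ps_mul_mbox _ _ aN) big_mkcond; apply: eq_bigr => b _.
case: (boolP (mle b a)) => ba; last first.
  by rewrite big1 // => c _; rewrite madd_eq (negPf ba).
have msN : msub a b \in mbox n N.
  by apply: mbox_le aN _; apply/forallP => i; rewrite ffunE leq_subr.
transitivity (\sum_(c <- mbox n N)
    if c == msub a b then f b * g (msub a b) else 0).
  by rewrite sum_mbox1 msN.
by apply: eq_bigr => c _; rewrite madd_eq ba /=; case: eqP => [->|].
Qed.

Lemma ps_mulC : commutative (@ps_mul F n).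
Proof.
move=> f g; apply: funext => a; rewrite !(ps_mul_pair _ _ (mbox_mdeg a)).
rewrite exchange_big; apply: eq_bigr => b _; apply: eq_bigr => c _.
by rewrite maddC mulrC.
Qed.

Lemma ps_mul_triple f g h a : ps_mul f (ps_mul g h) a =
  \sum_(b <- mbox n (mdeg a)) \sum_(d <- mbox n (mdeg a))
     \sum_(e <- mbox n (mdeg a))
     if madd b (madd d e) == a then f b * (g d * h e) else 0.
Proof.
have aN := mbox_mdeg a; set N := mdeg a in aN *.
rewrite (ps_mul_pair _ _ aN); apply: eq_bigr => b _.
transitivity (\sum_(c <- mbox n N) \sum_(d <- mbox n N) \sum_(e <- mbox n N)
   if c == madd d e then (if madd b c == a then f b * (g d * h e) else 0) else 0).
  rewrite [LHS]big_seq [RHS]big_seq; apply: eq_bigr => c cN.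
  rewrite (ps_mul_pair _ _ cN); case: eqP => bc; last first.
    by rewrite big1 // => d _; rewrite big1 // => e _; case: eqP.
  rewrite mulr_sumr; apply: eq_bigr => d _; rewrite mulr_sumr.
  by apply: eq_bigr => e _; rewrite eq_sym; case: eqP; rewrite ?mulr0.
rewrite exchange_big; apply: eq_bigr => d _.
rewrite exchange_big; apply: eq_bigr => e _.
transitivity (\sum_(c <- mbox n N) if c == madd d e then
   (if madd b (madd d e) == a then f b * (g d * h e) else 0) else 0).
  by apply: eq_bigr => c _; case: eqP => // ->.
rewrite sum_mbox1; case: ifP => // deN; case: eqP => // bde.
rewrite (mbox_le aN) // in deN; rewrite -bde; apply/forallP => i.
by rewrite !ffunE leq_addl.
Qed.

(** Commutativity turns the right side into another right-nested product, so [ps_mul_triple] applies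
    to both sides and only the order of the three indices differs. *)
Lemma ps_mulA : associative (@ps_mul F n).
Proof.
move=> f g h; rewrite [RHS]ps_mulC; apply: funext => a; rewrite !ps_mul_triple.
under [RHS]eq_bigr => b _ do under eq_bigr => d _ do under eq_bigr => e _ do
  rewrite maddC -maddA.
rewrite [RHS]exchange_big; apply: eq_bigr => b _.
rewrite [RHS]exchange_big; apply: eq_bigr => d _; apply: eq_bigr => e _.
by rewrite mulrA [in RHS]mulrC.
Qed.

Lemma ps_mulDl : left_distributive (@ps_mul F n) (@ps_add F n).
Proof.
move=> f g h; apply: funext => a; rewrite /ps_mul /ps_add -big_split /=.
by apply: eq_bigr => b _; rewrite mulrDl.
Qed.

Lemma ps_const_mul (c : F) g : ps_mul (@ps_const F n c) g = fun a => c * g a.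
Proof.
apply: funext => a; rewrite (ps_mul_pair _ _ (mbox_mdeg a)).
transitivity (\sum_(b <- mbox n (mdeg a))
    if b == [ffun=> 0%N] then c * g a else 0).
  apply: eq_bigr => b _; rewrite /ps_const; case: eqP => [->|_]; last first.
    by rewrite big1 // => d _; rewrite mul0r if_same.
  transitivity (\sum_(d <- mbox n (mdeg a)) if d == a then c * g a else 0).
    apply: eq_bigr => d _; rewrite (_ : madd _ _ = d); first by case: eqP => // ->.
    by apply/ffunP => i; rewrite !ffunE.
  by rewrite sum_mbox1 mbox_mdeg.
by rewrite sum_mbox1 mem_mbox ifT //; apply/forallP => i; rewrite ffunE.
Qed.

Lemma ps_mul1l : left_id (@ps_const F n (1 : F)) (@ps_mul F n).
Proof. by move=> g; rewrite ps_const_mul; apply: funext => a; rewrite mul1r. Qed.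

(** A separate name carries the Cauchy product, as opposed to the pointwise product that function
    types such as [nat -> E] carry below. *)
Definition psring : Type := ps F n.
HB.instance Definition _ := gen_eqMixin psring.
HB.instance Definition _ := gen_choiceMixin psring.

Definition ps_opp f : ps F n := fun a => - f a.

Lemma ps_addA : associative (@ps_add F n).
Proof. by move=> f g h; apply: funext => a; rewrite /ps_add addrA. Qed.
Lemma ps_addC : commutative (@ps_add F n).
Proof. by move=> f g; apply: funext => a; rewrite /ps_add addrC. Qed.
Lemma ps_add0 : left_id (@ps_const F n (0 : F)) (@ps_add F n).
Proof. by move=> f; apply: funext => a; rewrite /ps_add /ps_const if_same add0r. Qed.
Lemma ps_addN : left_inverse (@ps_const F n (0 : F)) ps_opp (@ps_add F n).
Proof.
by move=> f; apply: funext => a; rewrite /ps_add /ps_const if_same addNr.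
Qed.

HB.instance Definition _ :=
  GRing.isZmodule.Build psring ps_addA ps_addC ps_add0 ps_addN.

Lemma psring0E (a : mono n) : (0 : psring) a = 0.
Proof. by rewrite /GRing.zero /= /ps_const if_same. Qed.

Lemma ps_1neq0 : @ps_const F n (1 : F) != (0 : psring).
Proof.
apply/eqP => /(congr1 (fun f : ps F n => f [ffun=> 0%N])) /eqP.
by rewrite psring0E /ps_const eqxx oner_eq0.
Qed.

HB.instance Definition _ :=
  GRing.Zmodule_isComNzRing.Build psring ps_mulA ps_mulC ps_mul1l ps_mulDl ps_1neq0.

Definition psconst (c : F) : psring := @ps_const F n c.
Definition psaug (f : psring) : F := f [ffun=> 0%N].

Lemma psconst_is_zmod : zmod_morphism psconst.
Proof.
move=> x y; apply: funext => a; rewrite /psconst.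
change (@ps_const F n (x - y) a = @ps_const F n x a - @ps_const F n y a).
by rewrite /ps_const; case: eqP; rewrite ?subr0.
Qed.

Lemma psconst_is_monoid : monoid_morphism psconst.
Proof.
split=> // x y; change (@ps_const F n (x * y) = ps_mul (@ps_const F n x) (@ps_const F n y)).
rewrite ps_const_mul; apply: funext => a.
by rewrite /ps_const; case: eqP; rewrite ?mulr0.
Qed.

HB.instance Definition _ := GRing.isZmodMorphism.Build F psring psconst psconst_is_zmod.
HB.instance Definition _ := GRing.isMonoidMorphism.Build F psring psconst psconst_is_monoid.

Lemma psaug_is_zmod : zmod_morphism psaug.
Proof. by []. Qed.

Lemma psaug_is_monoid : monoid_morphism psaug.
Proof.
split=> [|f g]; first by rewrite /psaug /GRing.one /= /ps_const eqxx.
rewrite /psaug; change (ps_mul f g [ffun=> 0%N] = f [ffun=> 0%N] * g [ffun=> 0%N]).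
rewrite (ps_mul_mbox _ _ (mbox_mdeg _)) big_mkcond.
rewrite (bigD1_seq [ffun=> 0%N]) ?mbox_uniq ?mbox_mdeg //= big1 ?addr0.
  rewrite ifT; last by apply/forallP => i; rewrite ffunE.
  by congr (_ * g _); apply/ffunP => i; rewrite !ffunE.
move=> b /eqP bn0; case: ifP => // /forallP b0; case: bn0.
by apply/ffunP => i; apply/eqP; have := b0 i; rewrite !ffunE leqn0.
Qed.

HB.instance Definition _ := GRing.isZmodMorphism.Build psring F psaug psaug_is_zmod.
HB.instance Definition _ := GRing.isMonoidMorphism.Build psring F psaug psaug_is_monoid.

Lemma psconstK : cancel psconst psaug.
Proof. by move=> c; rewrite /psaug /psconst /ps_const eqxx. Qed.

Definition psvar (i : 'I_n) : psring := @ps_var F n i.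

Lemma psaug_var i : psaug (psvar i) = 0.
Proof.
rewrite /psaug /psvar /ps_var; case: eqP => // /ffunP /(_ i).
by rewrite !ffunE eqxx.
Qed.

End PowerSeries.

Arguments psconst {F} n c.

Lemma horner_taylor2 (R : comNzRingType) (h : {poly R}) (x d : R) :
  exists w, h.[x + d] = h.[x] + h^`().[x] * d + w * d ^+ 2.
Proof.
elim/poly_ind: h => [|p c [w IH]].
  by exists 0; rewrite deriv0 !horner0; ring.
exists (p^`().[x] + w * (x + d)).
rewrite derivD derivM derivX derivC !hornerE /= IH; ring.
Qed.

Lemma horner_diff (R : comNzRingType) (h : {poly R}) (x y : R) :
  exists w, h.[y] - h.[x] = w * (y - x).
Proof.
have [w] := horner_taylor2 h x (y - x); rewrite addrC subrK => ->.
by exists (h^`().[x] + w * (y - x)); ring.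
Qed.

(** Simple roots lift along the residue map [eps]. No monicity is asked of [h], so the lifting
    applies directly to non-monic minimal polynomials. *)
Definition henselian (F T : comNzRingType) (eps : T -> F) :=
  forall (h : {poly T}) (t : F), (map_poly eps h).[t] = 0 ->
    (map_poly eps h)^`().[t] != 0 -> exists2 p, eps p = t & h.[p] = 0.

(** * Order of vanishing and Hensel's lemma for power series *)

Section PowerSeriesHensel.
Variables (F : fieldType) (n : nat).
Local Notation T := (psring F n).
Implicit Types f g : T.

Definition psge k f := forall a : mono n, (mtot a < k)%N -> f a = 0.

Lemma psge0 f : psge 0 f. Proof. by []. Qed.

Lemma psge_le j k f : (j <= k)%N -> psge k f -> psge j f.
Proof. by move=> jk fk a aj; apply: fk; apply: leq_trans aj jk. Qed.

Lemma psgeD k f g : psge k f -> psge k g -> psge k (f + g).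
Proof.
move=> fk gk a ak; change (f a + g a = 0); by rewrite fk // gk // addr0.
Qed.

Lemma psgeM j k f g : psge j f -> psge k g -> psge (j + k) (f * g).
Proof.
move=> fj gk a ajk; change (ps_mul f g a = 0).
rewrite (ps_mul_mbox _ _ (mbox_mdeg a)) big1 // => b /mtot_sub ba.
case: (ltnP (mtot b) j) => bj; first by rewrite fj ?mul0r.
by rewrite gk ?mulr0 // -(ltn_add2l (mtot b)) ba (leq_trans ajk) // leq_add2r.
Qed.

Lemma psge1 f : psaug f = 0 -> psge 1 f.
Proof.
move=> f0 a; rewrite ltnS leqn0 sum_nat_eq0 => /forallP a0.
rewrite (_ : a = [ffun=> 0%N]) //; apply/ffunP => i; apply/eqP.
by rewrite ffunE; have := a0 i.
Qed.

Lemma psaug_ge f k : psge k.+1 f -> psaug f = 0.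
Proof. by apply; rewrite /mtot big1 // => i _; rewrite ffunE. Qed.

Lemma psaug_horner (h : {poly T}) (x : T) :
  psaug h.[x] = (map_poly (@psaug F n) h).[psaug x].
Proof. by rewrite horner_map. Qed.

(* Newton iteration with the constant slope [h'(t)] gains one order per step. *)
Lemma psring_henselian : henselian (@psaug F n).
Proof.
move=> h t ht h't; set s := _.[t] in h't.
pose N x : T := x - psconst n s^-1 * h.[x].
pose x k := iter k N (psconst n t).
have xP k : psaug (x k) = t /\ psge k.+1 h.[x k].
  elim: k => [|k [xt hx]].
    split; first exact: psconstK.
    by apply: psge1; rewrite psaug_horner /= psconstK.
  have dk : psge k.+1 (- (psconst n s^-1 * h.[x k])).
    by rewrite -mulNr -[k.+1]add0n; apply: psgeM.
  split; first by rewrite /= rmorphD /= xt (psaug_ge dk) addr0.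
  rewrite /= /N; have [w ->] := horner_taylor2 h (x k) (- (psconst n s^-1 * h.[x k])).
  apply: psgeD.
    (* The second factor has zero constant term because [x k] reduces to [t], so this product gains
       one order. The quadratic remainder has order at least [2(k+1)], which is at least [k+2]. *)
    rewrite (_ : _ + _ = h.[x k] * (1 - h^`().[x k] * psconst n s^-1)); last by ring.
    rewrite -addn1; apply: psgeM => //; apply: psge1.
    rewrite rmorphB rmorphM rmorph1 /= psconstK psaug_horner xt -deriv_map.
    by rewrite divff // subrr.
  rewrite -[k.+2]add0n; apply: psgeM => //.
  apply: (@psge_le _ (k.+1 + k.+1)); last exact: psgeM.
  by rewrite addSn addnS !ltnS leq_addl.
have xS k j (a : mono n) : (mtot a <= k)%N -> x (k + j)%N a = x k a.
  move=> ak; elim: j => [|j IH]; first by rewrite addn0.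
  rewrite addnS -IH; have [_ hx] := xP (k + j)%N.
  have : psge (k + j).+1 (psconst n s^-1 * h.[x (k + j)%N]).
    by rewrite -[_.+1]add0n; apply: psgeM.
  move=> /(_ a) d0; rewrite /= /N.
  change (x (k + j)%N a - (psconst n s^-1 * h.[x (k + j)%N]) a = x (k + j)%N a).
  by rewrite d0 ?subr0 // ltnS (leq_trans ak) ?leq_addr.
(* The limit of the iteration: by [xS] the coefficient at [a] no longer changes from iterate
   [mtot a] on. *)
pose p : T := fun a => x (mtot a) a.
have px k : psge k.+1 (p - x k).
  move=> a ak; change (x (mtot a) a - x k a = 0).
  by rewrite -(subnKC (_ : mtot a <= k)%N) // xS ?subrr.
exists p.
  have := psaug_ge (px 0%N); rewrite rmorphB /= (proj1 (xP 0%N)).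
  by move/eqP; rewrite subr_eq0 => /eqP.
(* The difference of the two values of [h] is a multiple of [p - x (mtot a)], hence has no
   coefficient at [a]; neither has [h.[x (mtot a)]]. *)
apply: funext => a; have [w E] := horner_diff h (x (mtot a)) p.
have := psgeM (@psge0 w) (px (mtot a)); rewrite -E => /(_ a (ltnSn _)).
change (h.[p] a - h.[x (mtot a)] a = 0 -> h.[p] a = (0 : T) a).
by rewrite (proj2 (xP (mtot a))) // subr0 psring0E.
Qed.

End PowerSeriesHensel.

(** * Minimal polynomials modulo the kernel of an evaluation *)

Section Adjunction.
Variables (A R : comNzRingType) (f : {rmorphism A -> R}) (y : R).

Definition adjoin_eval : {poly A} -> R := horner_eval y \o map_poly f.
HB.instance Definition _ := GRing.RMorphism.on adjoin_eval.

Lemma adjoin_evalE P : adjoin_eval P = (map_poly f P).[y]. Proof. by []. Qed.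

Lemma adjoin_evalC a : adjoin_eval a%:P = f a.
Proof. by rewrite adjoin_evalE map_polyC hornerC. Qed.

Lemma adjoin_evalX : adjoin_eval 'X = y.
Proof. by rewrite adjoin_evalE map_polyX hornerX. Qed.

End Adjunction.

Lemma take_poly_map (A R : nzRingType) (f : {rmorphism A -> R}) k (P : {poly A}) :
  (size (map_poly f P) <= k)%N -> map_poly f (take_poly k P) = map_poly f P.
Proof.
move=> Pk; apply/polyP => i; rewrite !coef_map coef_take_poly.
case: ltnP => // ki; rewrite raddf0; apply/esym.
by rewrite -coef_map nth_default // (leq_trans Pk).
Qed.

(* Polynomials over A are compared after applying [ev], so that [A] may be a
   polynomial ring standing for its image in [E]. *)
Section MinimalPolynomial.
Variables (E : fieldType) (A : idomainType) (ev : {rmorphism A -> E}) (y : E).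
Local Notation evy := (adjoin_eval ev y).

(** Truncation at the size of the image discards only coefficients in the kernel of [ev]. *)
Lemma lead_reduce (P : {poly A}) : map_poly ev P != 0 ->
  exists2 Q : {poly A}, map_poly ev Q = map_poly ev P & ev (lead_coef Q) != 0.
Proof.
move=> P0; exists (take_poly (size (map_poly ev P)) P).
  exact: take_poly_map.
set Q := take_poly _ _; have QP : map_poly ev Q = map_poly ev P by exact: take_poly_map.
have sQ : size Q = size (map_poly ev Q).
  apply/eqP; rewrite eqn_leq size_poly andbT QP; exact: size_take_poly.
by rewrite /lead_coef sQ -coef_map -lead_coefE lead_coef_eq0 QP.
Qed.

(** A minimal polynomial of [y] over the image of [ev], with denominators cleared: it is not monic,
    and relations of smaller degree are trivial only modulo the kernel of [ev]. *)
Definition minpoly (h : {poly A}) :=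
  [/\ ev (lead_coef h) != 0, evy h = 0 &
      forall r : {poly A}, (size r < size h)%N -> evy r = 0 -> map_poly ev r = 0].

Lemma minpoly_exists (P : {poly A}) :
  map_poly ev P != 0 -> evy P = 0 -> exists h, minpoly h.
Proof.
move=> /lead_reduce [Q QP Q0] Py.
pose ok d := `[< exists h : {poly A},
  [/\ size h = d, ev (lead_coef h) != 0 & evy h = 0] >].
have okQ : ok (size Q).
  by apply/asboolP; exists Q; split=> //; rewrite adjoin_evalE QP -adjoin_evalE.
case: (ex_minnP (ex_intro ok _ okQ)) => d /asboolP [h [sh h0 hy]] dmin.
exists h; split=> // r rh ry; apply/eqP; apply: contraT => r0.
have := rh; rewrite ltnNge sh; case/negP.
have [r' r'r lr'] := lead_reduce r0.
apply: (@leq_trans (size (map_poly ev r))); last exact: size_poly.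
rewrite -r'r size_map_poly_id0 //; apply: dmin; apply/asboolP; exists r'.
by split=> //; rewrite adjoin_evalE r'r -adjoin_evalE.
Qed.

Variable h : {poly A}.
Hypothesis hmin : minpoly h.

Lemma minpoly_neq0 : h != 0.
Proof. by case: hmin => h0 _ _; apply: contraNneq h0 => ->; rewrite lead_coef0 rmorph0. Qed.

Lemma minpoly_map : map_poly ev h != 0.
Proof.
case: hmin => h0 _ _; apply: contraNneq h0 => H.
by rewrite lead_coefE -coef_map H coef0.
Qed.

Lemma minpoly_size : (1 < size h)%N.
Proof.
case: hmin => h0 hy _; rewrite ltnNge; apply: contraNN h0 => /size1_polyC hC.
by move: hy; rewrite hC adjoin_evalC lead_coefC => ->.
Qed.

(** Pseudo-divide [P] by [h]. The remainder vanishes at [y], so minimality puts its coefficients in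
    the kernel of [ev], and [psi] kills them. What is left is a power of the leading coefficient
    times the value of [P], and that power cancels. *)
Lemma minpoly_kill (R : comNzRingType) (psi : {rmorphism A -> R}) (t : R) :
    (forall a, ev a = 0 -> psi a = 0) -> GRing.lreg (psi (lead_coef h)) ->
    adjoin_eval psi t h = 0 ->
  forall P, evy P = 0 -> adjoin_eval psi t P = 0.
Proof.
case: hmin => h0 hy hm psi0 reg th P Py.
have := Pdiv.Idomain.divp_eq P h; set k := scalp _ _ => Eq.
have r0 : map_poly ev (P %% h) = 0.
  apply: hm; first by rewrite Pdiv.Idomain.ltn_modpN0 // minpoly_neq0.
  have := congr1 evy Eq; rewrite -mul_polyC rmorphD !rmorphM /= hy Py !mulr0 add0r.
  by move=> <-.
have r0' : adjoin_eval psi t (P %% h) = 0.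
  rewrite adjoin_evalE (_ : map_poly psi _ = 0) ?horner0 //.
  apply/polyP => i; rewrite coef_map coef0 /= psi0 //.
  by rewrite -coef_map r0 coef0.
have := congr1 (adjoin_eval psi t) Eq.
rewrite -mul_polyC rmorphD !rmorphM /= th r0' mulr0 addr0 adjoin_evalC rmorphXn /= => H.
by apply: (lregX (n := k) reg); rewrite mulr0.
Qed.

(* Among the multiples of [G] modulo [h] with nonzero value at [y], one of least
   size is constant, else dividing [h] by it would produce a smaller one. *)
Lemma minpoly_inverse (G : {poly A}) : evy G != 0 ->
  exists U b, ev b != 0 /\ evy (U * G) = ev b.
Proof.
case: (hmin) => h0 hy hm Gy.
pose ok d := `[< exists U r : {poly A},
  [/\ size r = d, evy r = evy (U * G) & evy r != 0] >].
have okG : ok (size G) by apply/asboolP; exists 1, G; rewrite mul1r.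
case: (ex_minnP (ex_intro ok _ okG)) => d /asboolP [U [r [sr rU r0]]] dmin.
have minr (s V : {poly A}) : evy s = evy (V * G) -> evy s != 0 -> (size r <= size s)%N.
  by move=> sV s0; rewrite sr; apply: dmin; apply/asboolP; exists V, s.
case: (leqP (size r) 1) => [/size1_polyC rC|r1].
  exists U, r`_0; split; last by rewrite -rU {1}rC adjoin_evalC.
  by move: r0; rewrite {1}rC adjoin_evalC.
exfalso.
have rn0 : r != 0 by apply: contraNneq r0 => ->; rewrite rmorph0.
have lr0 : ev (lead_coef r) != 0.
  apply/eqP => lr0; have := minr (take_poly (size r).-1 r) U.
  have E0 : map_poly ev (take_poly (size r).-1 r) = map_poly ev r.
    apply/polyP => i; rewrite !coef_map coef_take_poly.
    case: ltngtP => // [ri|->]; last by rewrite raddf0 -lead_coefE /= lr0.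
    by rewrite nth_default // -(prednK (ltnW r1)).
  rewrite adjoin_evalE E0 -adjoin_evalE => /(_ rU r0).
  apply/negP; rewrite -ltnNge (leq_ltn_trans (size_take_poly _ _)) //.
  by rewrite prednK // ltnW.
have rh : (size r < size h)%N.
  rewrite ltnNge; apply/negP => hr.
  have := Pdiv.Idomain.divp_eq r h; set k := scalp _ _ => Eq.
  have My : evy (r %% h) = ev (lead_coef h) ^+ k * evy r.
    have := congr1 evy Eq; rewrite -mul_polyC rmorphD !rmorphM /= hy mulr0 add0r => <-.
    by rewrite adjoin_evalC rmorphXn.
  have := minr (r %% h) ((lead_coef h ^+ k) *: U).
  rewrite My -mul_polyC -mulrA rmorphM /= -rU adjoin_evalC rmorphXn /=.
  rewrite mulf_neq0 ?expf_neq0 // => /(_ erefl isT).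
  apply/negP; rewrite -ltnNge (leq_trans _ hr) //.
  by rewrite Pdiv.Idomain.ltn_modpN0 // minpoly_neq0.
(* Minimality of [r] forces the remainder to vanish at [y], and then the quotient too, as [r] does
   not. Both are shorter than [h] (the quotient because [r] is nonconstant), so both map to zero;
   then so does [h] times a power of the leading coefficient of [r], which is absurd. *)
have := Pdiv.Idomain.divp_eq h r; set k := scalp _ _ => Eq.
have sr' : (size (h %% r)%R < size r)%N by rewrite Pdiv.Idomain.ltn_modpN0.
have Eqy : 0 = evy (h %/ r) * evy r + evy (h %% r).
  by have := congr1 evy Eq; rewrite -mul_polyC rmorphD !rmorphM /= hy mulr0.
have m0 : evy (h %% r) = 0.
  apply/eqP; apply: contraT => m0.
  have := minr (h %% r) (- (h %/ r) * U).
  rewrite -mulrA rmorphM rmorphN /= -rU => H.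
  have : evy (h %% r) = - evy (h %/ r) * evy r.
    by rewrite mulNr; apply/eqP; rewrite -addr_eq0 addrC -Eqy.
  by move=> /H /(_ m0); rewrite leqNgt sr'.
have q0 : evy (h %/ r) = 0.
  by move/esym/eqP: Eqy; rewrite m0 addr0 mulf_eq0 (negPf r0) orbF => /eqP.
have mm : map_poly ev (h %% r) = 0 by apply: hm => //; apply: ltn_trans rh.
have qq : map_poly ev (h %/ r) = 0.
  apply: hm => //; case: (eqVneq (h %/ r) 0) => [->|qn0].
    by rewrite size_poly0 ltnW // minpoly_size.
  have : (size ((h %/ r) * r)%R <= size h)%N.
    have -> : (h %/ r) * r = lead_coef r ^+ k *: h - h %% r by rewrite Eq addrK.
    apply: leq_trans (size_polyD _ _) _; rewrite geq_max size_polyN size_scale_leq.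
    exact: ltnW (ltn_trans sr' rh).
  rewrite size_mul //; apply: leq_trans.
  by move: r1; case: (size r) => [|[|m]] // _; rewrite !addnS /= ltnS leq_addr.
have := congr1 (map_poly ev) Eq; rewrite rmorphD rmorphM /= qq mm mul0r addr0.
rewrite map_polyZ => /eqP; rewrite scaler_eq0 (negPf minpoly_map) orbF rmorphXn /=.
by rewrite expf_eq0 (negPf lr0) andbF.
Qed.

(** Separability: were the derivative to vanish at [y], minimality would kill its top coefficient,
    which is a positive integer times the leading coefficient of [h]. *)
Lemma minpoly_deriv : [pchar E] =i pred0 -> evy h^`() != 0.
Proof.
move=> ch; case: (hmin) => h0 hy hm; apply/negP => /eqP h'y.
have /hm /(_ h'y) : (size h^`() < size h)%N by rewrite lt_size_deriv // minpoly_neq0.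
move/(congr1 (fun p : {poly E} => p`_(size h).-2)); rewrite coef_map coef0 coef_deriv.
rewrite raddfMn /= prednK -?lead_coefE; last by rewrite -subn1 subn_gt0 minpoly_size.
move/eqP; rewrite -mulr_natr mulf_eq0 (negPf h0) /=.
have := (pcharf0P E).1 ch; move=> /(_ (size h).-1) ->.
by rewrite -subn1 subn_eq0 leqNgt minpoly_size.
Qed.

End MinimalPolynomial.

(** * Specializations with prescribed nonvanishing *)

Section GenericPoints.
Variables (F : closedFieldType) (T : comNzRingType).
Variables (eps : {rmorphism T -> F}) (kappa : {rmorphism F -> T}).
Hypotheses (kappaK : cancel kappa eps) (hens : henselian eps).

(** Zariski density of the residues of the [T]-valued points of the image of [ev]; [adm] records
    what has been prescribed on generators so far. *)
Definition dense_points (E : fieldType) (A : idomainType) (ev : A -> E)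
    (adm : (A -> T) -> Prop) :=
  forall g, ev g != 0 -> exists phi : {rmorphism A -> T},
    [/\ adm phi, forall a, ev a = 0 -> phi a = 0 & eps (phi g) != 0].

(** Lifting the root of [u *: 'X - 1] inverts [u]. *)
Lemma henselian_unit (u : T) : eps u != 0 -> GRing.lreg u.
Proof.
move=> u0; have := hens (h := u *: 'X - 1) (t := (eps u)^-1).
rewrite rmorphB rmorph1 /= map_polyZ map_polyX !hornerE divff // subrr.
rewrite derivD derivN derivZ derivX derivC !hornerE subr0 /=.
case=> // v _; rewrite !hornerE => /eqP; rewrite subr_eq0 => /eqP uv a b ab.
by rewrite -[a]mul1r -[b]mul1r -uv [u * v]mulrC -!mulrA ab.
Qed.

Variables (E : fieldType) (A : idomainType) (ev : {rmorphism A -> E}).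
Variables (adm : (A -> T) -> Prop) (dense : dense_points ev adm).

Lemma dense_points_transcendental (y : E) (q : T) :
    (forall P, adjoin_eval ev y P = 0 -> map_poly ev P = 0) -> eps q = 0 ->
  dense_points (adjoin_eval ev y)
    (fun phi => adm (phi \o polyC) /\ exists c, phi 'X = q + kappa c).
Proof.
move=> ytr q0 g gy.
(* Keeping one coefficient of [g] nonzero leaves a nonzero polynomial over [F]; any [c] off its
   roots will do, since the residue of [q + kappa c] is [c]. *)
have [i gi] : exists i, ev g`_i != 0.
  apply: contrapT => H; case/eqP: gy; rewrite adjoin_evalE (_ : map_poly ev g = 0) ?horner0 //.
  by apply/polyP => i; rewrite coef_map coef0 /=; apply/eqP/negPn/negP => gi; apply: H; exists i.
have [phi [phiadm phi0 phig]] := dense gi.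
have [c gc] : exists c, (map_poly (eps \o phi) g).[c] != 0.
  apply/closed_nonrootP; apply: contraNneq phig => H.
  by have := congr1 (fun p : {poly F} => p`_i) H; rewrite coef_map coef0 /= => ->.
exists (adjoin_eval phi (q + kappa c)); split.
- split; last by exists c; rewrite /= adjoin_evalX.
  by rewrite (_ : _ \o _ = phi) //; apply: funext => a /=; rewrite adjoin_evalC.
- move=> P /ytr P0; rewrite /= adjoin_evalE (_ : map_poly phi P = 0) ?horner0 //.
  by apply/polyP => j; rewrite coef_map coef0 /= phi0 // -coef_map P0 coef0.
- by rewrite /= adjoin_evalE -horner_map /= rmorphD /= q0 kappaK add0r -map_poly_comp.
Qed.

Lemma dense_points_algebraic (y : E) (P : {poly A}) :
    [pchar E] =i pred0 -> map_poly ev P != 0 -> adjoin_eval ev y P = 0 ->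
  dense_points (adjoin_eval ev y) (fun phi => adm (phi \o polyC)).
Proof.
move=> chE P0 Py g gy; have [h hmin] := minpoly_exists P0 Py.
have [h0 hy _] := hmin; have h'y := minpoly_deriv hmin chE.
(* Here [b] plays the part of a resultant: where it survives, neither [g] nor the derivative of [h]
   can vanish at a root of [h]. Keeping the leading coefficient of [h] as well guarantees that the
   specialized [h] has a root. *)
have [|U [b [b0 Ub]]] := minpoly_inverse hmin (G := g * h^`()).
  by rewrite rmorphM mulf_neq0.
have [|phi [phiadm phi0]] := dense (g := lead_coef h * b).
  by rewrite rmorphM mulf_neq0.
rewrite !rmorphM /= mulf_eq0 negb_or => /andP[phil phib].
have [t /eqP ht] : exists t, root (map_poly (eps \o phi) h) t.
  apply/closed_rootP; rewrite size_map_poly_id0 //= neq_ltn.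
  by rewrite (minpoly_size hmin) orbT.
have kill : adjoin_eval (eps \o phi) t (U * (g * h^`()) - b%:P) = 0.
  apply: (minpoly_kill hmin) => //; last 1 first.
  - by rewrite rmorphB /= Ub adjoin_evalC subrr.
  - by move=> a /phi0 /= ->; rewrite rmorph0.
  - exact: mulfI.
move: kill; rewrite rmorphB !rmorphM /= adjoin_evalC => /eqP; rewrite subr_eq0 => /eqP kill.
have : eps (phi b) != 0 by [].
rewrite -[eps _]kill !mulf_eq0 !negb_or => /and3P[_ gt h't].
have [||p pt hp] := hens (h := map_poly phi h) (t := t).
- by rewrite -map_poly_comp.
- by rewrite -map_poly_comp deriv_map.
exists (adjoin_eval phi p); split.
- by rewrite (_ : _ \o _ = phi) //; apply: funext => a /=; rewrite adjoin_evalC.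
(* [T] is not known to be a domain, so regularity of the leading coefficient comes from its nonzero
   residue. *)
- by apply: (minpoly_kill hmin) => //; apply: henselian_unit.
- by rewrite /= adjoin_evalE -horner_map /= pt -map_poly_comp.
Qed.

Lemma dense_points_adjoin (y : E) : [pchar E] =i pred0 ->
  dense_points (adjoin_eval ev y) (fun phi => adm (phi \o polyC)).
Proof.
move=> chE.
have [[P [P0 Py]]|nalg] := pselect (exists P, map_poly ev P != 0 /\ adjoin_eval ev y P = 0).
  exact: dense_points_algebraic chE P0 Py.
move=> g gy; have [|//|phi [[phiadm _] phi0 phig]] :=
  dense_points_transcendental (y := y) (q := 0) _ _ gy.
- by move=> P Py; apply/eqP/negPn/negP => P0; apply: nalg; exists P.
- by rewrite rmorph0.
- by exists phi.
Qed.

End GenericPoints.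

(** * Ultrapowers *)

Section Ultrapower.
Local Open Scope quotient_scope.
Local Open Scope classical_set_scope.
Variables (E : fieldType) (U : set_system nat).
Hypothesis ultra : UltraFilter U.

Definition ultra_null : (nat -> E) -> bool := fun f => `[< U [set t | f t = 0] >].

Lemma ultra_null_ideal : idealr_closed ultra_null.
Proof.
split=> [||a f g /asboolP fU /asboolP gU].
- by apply/asboolP; apply: filterS filterT.
- apply/negP => /asboolP /filter_ex[t /= /eqP].
  by rewrite oner_eq0.
- apply/asboolP; apply: filterS (filterI fU gU) => t [/= ft gt].
  by change (a t * f t + g t = 0); rewrite ft gt mulr0 addr0.
Qed.

HB.instance Definition _ := isIdealr.Build (nat -> E) ultra_null ultra_null_ideal.

Definition ultra_ideal : idealr (nat -> E) := ultra_null.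

Definition ultrapower : Type := {ideal_quot ultra_ideal}.
HB.instance Definition _ := GRing.ComNzRing.on ultrapower.

Definition ultra_class (f : nat -> E) : ultrapower := \pi_{ideal_quot ultra_ideal} f.

Lemma ultra_class_zmod : zmod_morphism ultra_class.
Proof. by move=> f g; rewrite /ultra_class !piE. Qed.

Lemma ultra_class_monoid : monoid_morphism ultra_class.
Proof. by split=> [|f g]; rewrite /ultra_class !piE. Qed.

HB.instance Definition _ :=
  GRing.isZmodMorphism.Build (nat -> E) ultrapower ultra_class ultra_class_zmod.
HB.instance Definition _ :=
  GRing.isMonoidMorphism.Build (nat -> E) ultrapower ultra_class ultra_class_monoid.

Lemma ultra_class_surj x : exists f, ultra_class f = x.
Proof. by exists (repr x); exact: reprK. Qed.

Lemma ultra_class_eq0 f : ultra_class f = 0 <-> U [set t | f t = 0].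
Proof.
have -> : (ultra_class f = 0) = (ultra_null f : Prop).
  rewrite -(rmorph0 ultra_class) propeqE.
  transitivity (f - 0 \in ultra_ideal : Prop); last by rewrite subr0.
  by rewrite Quotient.idealrBE; split=> /eqP.
by split=> /asboolP.
Qed.

Definition ultra_inv (x : ultrapower) : ultrapower :=
  ultra_class (fun t => (repr x t)^-1).

(** The ultrafilter dichotomy: if the zero set of a representative is not in [U], its complement is,
    and there the pointwise inverse works. *)
Lemma ultra_mulVf x : x != 0 -> ultra_inv x * x = 1.
Proof.
move=> x0; have xK : ultra_class (repr x) = x by exact: reprK.
apply/eqP; rewrite -subr_eq0; apply/eqP.
rewrite -{2}xK -(rmorph1 ultra_class) -rmorphM -rmorphB; apply/ultra_class_eq0.
have [] := in_ultra_setVsetC [set t | repr x t = 0] ultra.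
  by move=> /ultra_class_eq0 /eqP; rewrite xK (negPf x0).
apply: filterS => t /= /eqP xt.
by change ((repr x t)^-1 * repr x t - 1 = 0); rewrite mulVf // subrr.
Qed.

Lemma ultra_inv0 : ultra_inv 0 = 0.
Proof.
have /ultra_class_eq0 H : ultra_class (repr (0 : ultrapower)) = 0 by exact: reprK.
by apply/ultra_class_eq0; apply: filterS H => t /= ->; rewrite invr0.
Qed.

HB.instance Definition _ :=
  GRing.ComNzRing_isField.Build ultrapower ultra_mulVf ultra_inv0.

End Ultrapower.

(** * Transport of polynomial evaluation and of image inclusions to ultrapowers *)

Lemma meval_morph (C : Type) (R S : comNzRingType) (f : {rmorphism R -> S})
    (emb : C -> R) k (p : mpoly C k) (x : 'I_k -> R) :
  f (meval 0 1 +%R *%R emb p x) = meval 0 1 +%R *%R (f \o emb) p (f \o x).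
Proof.
elim: p => [|t p IH] /=; first exact: rmorph0.
rewrite rmorphD rmorphM /= IH; congr (_ * _ + _).
elim: (enum 'I_k) => [|i s IHs] /=; first exact: rmorph1.
rewrite rmorphM /= IHs; congr (_ * _).
by elim: (t.2 i) => [|e IHe] /=; rewrite ?rmorph1 // rmorphM /= IHe.
Qed.

Lemma natr_inj_pchar0 (E : idomainType) : [pchar E] =i pred0 ->
  injective (fun t : nat => t%:R : E).
Proof.
move=> /pcharf0P ch; have le t u : (t <= u)%N -> t%:R = u%:R :> E -> t = u.
  move=> tu /eqP; rewrite eq_sym -subr_eq0 -natrB // ch subn_eq0 => ut.
  by apply/eqP; rewrite eqn_leq tu.
by move=> t u tu; case: (leqP t u) => [|/ltnW] H; [|apply/esym]; apply: le.
Qed.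

Lemma natr_roots_bounded (E : idomainType) (P : {poly E}) :
  [pchar E] =i pred0 -> P != 0 -> exists N, forall t, (N <= t)%N -> P.[t%:R] != 0.
Proof.
move=> chE P0; apply: contrapT => H.
(* If roots occurred beyond every bound, there would be arbitrarily many distinct natural ones,
   exceeding the degree of [P]. *)
have many k : exists s : seq nat,
    [/\ uniq s, size s = k & all (fun t => root P t%:R) s].
  elim: k => [|k [s [us ss rs]]]; first by exists [::].
  have [t [ts rt]] : exists t, (\max_(u <- s) u.+1 <= t)%N /\ root P t%:R.
    apply: contrapT => H'; apply: H; exists (\max_(u <- s) u.+1)%N => t ts.
    by apply/negP => rt; apply: H'; exists t.
  exists (t :: s); rewrite /= us ss rt rs andbT; split=> //.
  apply: contraTN ts => ts; rewrite -ltnNge.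
  exact: (leq_bigmax_seq (F := S)).
have [s [us ss rs]] := many (size P).
have := max_poly_roots (rs := [seq t%:R | t <- s]) P0.
rewrite all_map map_inj_uniq; last exact: natr_inj_pchar0.
by rewrite size_map ss ltnn => /(_ rs us).
Qed.

Section Coordinates.
Variable E : comNzRingType.

Definition diagonal (a : E) : nat -> E := fun=> a.
Definition coordinate (t : nat) (f : nat -> E) : E := f t.

Lemma diagonal_zmod : zmod_morphism diagonal. Proof. by []. Qed.
Lemma diagonal_monoid : monoid_morphism diagonal. Proof. by []. Qed.
HB.instance Definition _ :=
  GRing.isZmodMorphism.Build E (nat -> E) diagonal diagonal_zmod.
HB.instance Definition _ :=
  GRing.isMonoidMorphism.Build E (nat -> E) diagonal diagonal_monoid.

Lemma coordinate_zmod t : zmod_morphism (coordinate t). Proof. by []. Qed.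
Lemma coordinate_monoid t : monoid_morphism (coordinate t). Proof. by []. Qed.
HB.instance Definition _ t :=
  GRing.isZmodMorphism.Build (nat -> E) E (coordinate t) (coordinate_zmod t).
HB.instance Definition _ t :=
  GRing.isMonoidMorphism.Build (nat -> E) E (coordinate t) (coordinate_monoid t).

End Coordinates.

Section ImageInclusion.
Variables (C : Type) (n m r : nat) (L : 'I_m -> mpoly C n) (M : 'I_m -> mpoly C r).

Definition image_incl (R : comNzRingType) (emb : C -> R) :=
  forall x : 'I_n -> R, exists y : 'I_r -> R, forall j,
    meval 0 1 +%R *%R emb (L j) x = meval 0 1 +%R *%R emb (M j) y.

(* In an ultrapower over nat the class of [t |-> t%:R] is transcendental over the
   diagonal, and image inclusions are inherited by solving coordinatewise. *)
Lemma generic_extension (E : fieldType) : [pchar E] =i pred0 ->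
  exists (E' : fieldType) (i : {rmorphism E -> E'}) (z : E'),
    (forall P : {poly E}, (map_poly i P).[z] = 0 -> P = 0) /\
    (forall emb : C -> E, image_incl emb -> image_incl (i \o emb)).
Proof.
move=> chE.
(* [U] contains every tail of [nat]; this makes the class of [t |-> t%:R] differ from all roots of
   polynomials over [E]. *)
have [U [ultra oU]] := ultraFilterLemma eventually_filter.
pose pi : {rmorphism (nat -> E) -> ultrapower E ultra} := @ultra_class E U ultra.
exists (ultrapower E ultra), (pi \o @diagonal E), (pi (fun t => t%:R)); split.
  move=> P; rewrite map_poly_comp horner_map => /ultra_class_eq0 PU.
  apply/eqP; apply: contraT => P0.
  have [N PN] := natr_roots_bounded chE P0.
  have /(filterI PU) /filter_ex[t [/= Pt /PN]] : U [set t | (N <= t)%N]%classic.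
    by apply: oU; exists N.
  rewrite -[P.[_]]/(P.[coordinate t (fun t => t%:R)]).
  rewrite -[P](_ : map_poly (@coordinate E t) (map_poly (@diagonal E) P) = P).
    by rewrite horner_map /= /coordinate Pt eqxx.
  by rewrite -map_poly_comp map_poly_id.
move=> emb incl x.
have [xr xrE] := choice (fun k => ultra_class_surj (x k)).
have [y yE] := choice (fun t : nat => incl (fun k => xr k t)).
exists (fun k => pi (fun t => y t k)) => j.
have -> : x = pi \o xr by apply: funext => k /=; rewrite -xrE.
rewrite -[_ \o emb]/(pi \o (@diagonal E \o emb)) -!meval_morph; congr (pi _).
apply: funext => t; have := yE t j.
(* Each datum is displayed as the image under [coordinate t] of a sequence, so that [meval_morph]
   identifies evaluation at index [t] with the [t]-th coordinate of the evaluation. *)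
rewrite -[emb]/(coordinate t \o (@diagonal E \o emb)).
rewrite -[fun k => xr k t]/(coordinate t \o xr).
rewrite -[y t]/(coordinate t \o (fun k t => y t k)).
by rewrite -!meval_morph.
Qed.

End ImageInclusion.

(** * Generic points and their specialization to power series *)

Section Main.
Variables (F : closedFieldType) (hchar : [pchar F] =i pred0) (n : nat).
Local Notation T := (psring F n).
Local Notation dense := (@dense_points F T (@psaug F n)).

Lemma dense_points_sub (E : fieldType) (A : idomainType) (ev : A -> E)
    (adm adm' : (A -> T) -> Prop) :
  (forall phi, adm phi -> adm' phi) -> dense ev adm -> dense ev adm'.
Proof. by move=> sub d g /d [phi [/sub H1 H2 H3]]; exists phi. Qed.

Lemma adjoin_list (E : fieldType) (A : idomainType) (ev : {rmorphism A -> E})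
    (adm : (A -> T) -> Prop) (ys : seq E) :
    [pchar E] =i pred0 -> dense ev adm ->
  exists (B : idomainType) (evB : {rmorphism B -> E}) (i : {rmorphism A -> B}),
    [/\ forall a, evB (i a) = ev a, forall y, y \in ys -> exists b, evB b = y
      & dense evB (fun phi => adm (phi \o i))].
Proof.
move=> chE d; elim: ys => [|y ys [B [evB [i [evi ysB dB]]]]].
  by exists A, ev, idfun.
exists {poly B}, (adjoin_eval evB y), (polyC \o i); split.
- by move=> a /=; rewrite adjoin_evalC.
- move=> z; rewrite inE => /predU1P[->|/ysB [b bz]].
    by exists 'X; exact: adjoin_evalX.
  by exists b%:P; rewrite /= adjoin_evalC.
- exact: (dense_points_adjoin (@psconstK F n) (@psring_henselian F n) dB).
Qed.

Variables (m r : nat) (L : 'I_m -> mpoly F n) (M : 'I_m -> mpoly F r).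

(** Only the first [k] coordinates are constrained, which lets the tower be built by induction on
    [k]. *)
Definition translation k (A : idomainType) (j : F -> A) (z : 'I_n -> A)
    (phi : A -> T) : Prop :=
  (forall a, phi (j a) = psconst n a) /\
  (forall i : 'I_n, (i < k)%N -> exists c, phi (z i) = psvar F i + psconst n c).

(** Each step passes to an ultrapower of the current field and adds one polynomial variable to [A],
    evaluated at the new transcendental element and sent to [psvar] plus a constant. *)
Lemma generic_tower k : image_incl L M (@idfun F) -> (k <= n)%N ->
  exists (E : fieldType) (A : idomainType) (ev : {rmorphism A -> E})
      (j : {rmorphism F -> A}) (z : 'I_n -> A),
    [/\ [pchar E] =i pred0, image_incl L M (ev \o j) & dense ev (translation k j z)].
Proof.
move=> incl; elim: k => [_|k IH kn].
  exists F, F, idfun, idfun, (fun=> 0); split=> // g g0.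
  by exists (psconst n); split=> //= [a ->|]; rewrite ?rmorph0 // psconstK.
have [E [A [ev [j [z [chE inclE d]]]]]] := IH (ltnW kn).
have [E' [i [x [xtr iincl]]]] := generic_extension L M chE.
exists E', {poly A}, (adjoin_eval (i \o ev) x), (polyC \o j).
(* Coordinates of index above [k] still hold the placeholder 0 of the base case. *)
exists (fun t : 'I_n => if t == k :> nat then 'X else (z t)%:P).
have d' : dense (i \o ev) (translation k j z).
  move=> g; rewrite /= fmorph_eq0 => /d [phi [H1 H2 H3]]; exists phi; split=> //.
  by move=> a /= /eqP; rewrite fmorph_eq0 => /eqP /H2.
(* The new element is transcendental over the whole field [E], hence over the image of [A]. *)
have tr P : adjoin_eval (i \o ev) x P = 0 -> map_poly (i \o ev) P = 0.
  rewrite adjoin_evalE map_poly_comp => /xtr ->; exact: rmorph0.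
split.
- by move=> p; rewrite (fmorph_pchar i).
- have -> : adjoin_eval (i \o ev) x \o (polyC \o j) = i \o (ev \o j).
    by apply: funext => a /=; rewrite adjoin_evalC.
  exact: iincl.
- pose kk := Ordinal kn.
  apply: dense_points_sub (dense_points_transcendental (@psconstK F n) d' tr (psaug_var F kk)).
  move=> phi [[phiF phiz] [c phiX]]; split=> [a|t]; first exact: phiF.
  rewrite ltnS leq_eqVlt; case: eqP => [tk _|_ /phiz //].
  by exists c; rewrite phiX (_ : kk = t) //; apply/val_inj.
Qed.

End Main.

Theorem theorem1p14 (F : closedFieldType) (hchar : [pchar F] =i pred0)
  (n m r : nat) (L : 'I_m -> mpoly F n) (M : 'I_m -> mpoly F r)
  (himg : forall x : 'I_n -> F, exists y : 'I_r -> F,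
            forall j : 'I_m, peval (L j) x = peval (M j) y) :
  exists (c : 'I_n -> F) (p : 'I_r -> ps F n),
    forall (j : 'I_m) (a : mono n),
      ps_eval (L j) (fun i => @ps_add F n (@ps_var F n i) (@ps_const F n (c i))) a
      = ps_eval (M j) p a.
Proof.
have [E [A [ev [j [z [chE incl d]]]]]] := generic_tower hchar himg (leqnn n).
have [y yE] := incl (ev \o z).
(* The solution [y] lives in the field [E]; enlarging [A] to [B] gives its entries preimages [w], on
   which a specialization can be evaluated. *)
have [B [evB [i [evi yB dB]]]] := adjoin_list (codom y) chE d.
have [w wE] := choice (fun k => yB _ (codom_f y k)).
(* A single specialization suffices now; nonvanishing mattered only while adjoining generators. *)
have [|phi [[phiF phiz] phi0 _]] := dB 1; first by rewrite rmorph1 oner_eq0.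
have [c cE] := choice (fun k : 'I_n => phiz k (ltn_ord k)).
exists c, (phi \o w) => k a.
set X := meval 0 1 +%R *%R (i \o j) (L k) (i \o z).
set Y := meval 0 1 +%R *%R (i \o j) (M k) w.
have emb : evB \o (i \o j) = ev \o j by apply: funext => b /=; rewrite evi.
have XY : evB X = evB Y.
  rewrite !meval_morph emb.
  have -> : evB \o (i \o z) = ev \o z by apply: funext => b /=; rewrite evi.
  by rewrite yE; congr (meval _ _ _ _ _ _ _); apply: funext => b /=; rewrite wE.
(* [X] and [Y] may differ in [B], but their difference lies in the kernel of [evB], which [phi]
   kills. *)
have : phi X = phi Y.
  apply/eqP; rewrite -subr_eq0 -rmorphB; apply/eqP/phi0.
  by rewrite rmorphB /= XY subrr.
have const : phi \o (i \o j) = psconst n by apply: funext => b; exact: phiF.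
rewrite !meval_morph const.
have -> : phi \o (i \o z) = fun t => psvar F t + psconst n (c t).
  by apply: funext => t; exact: cE.
(* The operations of [psring] unfold to those of [ps_eval], so the coefficients agree by
   conversion. *)
by move=> /(congr1 (fun f : ps F n => f a)).
Qed.
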